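(* Let $s \ge 2$ and let $\Sigma = \{{\tt 0}, {\tt 1}, \ldots, s-1\}$, whose letters are identified with the base-$s$ digits. Let $m, n$ be integers with $0 < m < n < 2m$ and $\gcd(m,n) = 1$, and let $S = (\Sigma^m \cup \Sigma^n) \setminus T(m,n)$. Then $S^*$ is co-finite, and the longest words in $\Sigma^* \setminus S^*$ have length exactly $g(m,l) = ml - m - l$, where $l = m s^{n-m} + n - m$.
   Context: For integers $N \ge 0$, $k \ge 2$, $L \ge 1$ with $N < k^L$, $r(N, k, L)$ denotes the word of length $L$ over the digits $\{0,\ldots,k-1\}$ representing $N$ in base $k$, padded with leading zeros. For integers $0 < m < n$, $T(m,n) = \{ r(i, s, n-m)\,{\tt 0}^{2m-n}\, r(i+1, s, n-m) : 0 \le i \le s^{n-m} - 2 \}$. $\Sigma^j$ is the set of words of length $j$ over $\Sigma$; a language $L \subseteq \Sigma^*$ is co-finite if $\Sigma^* \setminus L$ is finite. *)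

(* Defs.v *)
From mathcomp Require Import all_boot.
From mathcomp Require Import boolp classical_sets cardinality.

Set Implicit Arguments.
Unset Strict Implicit.
Unset Printing Implicit Defensive.

Local Open Scope classical_set_scope.

(* r(N, k, L), most significant digit first; for N >= k ^ L only the L low
   order digits are kept, a case that does not arise below. *)
Fixpoint base_rep (N k L : nat) : seq nat :=
  if L is L'.+1 then rcons (base_rep (N %/ k) k L') (N %% k) else [::].

Definition words_of_length (A : Type) (j : nat) : set (seq A) :=
  [set w | size w = j].

Definition kleene_star (A : eqType) (L : set (seq A)) : set (seq A) :=
  [set w | exists2 us : seq (seq A),
     (forall u, u \in us -> L u) & w = flatten us].

Definition cofinite_language (A : Type) (L : set (seq A)) : Prop :=
  finite_set (~` L).

(* Letters are the ordinals below s, compared with digits through val. For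
   0 < m < n < 2m and s >= 2 no subtraction is truncated. *)
Definition T (s m n : nat) : set (seq 'I_s) :=
  [set w | exists2 i : nat, i <= s ^ (n - m) - 2 &
     map val w = base_rep i s (n - m) ++ nseq (2 * m - n) 0
                   ++ base_rep i.+1 s (n - m)].

Definition S_lang (s m n : nat) : set (seq 'I_s) :=
  (words_of_length m `|` words_of_length n) `\` T m n.

(* Frobenius number of a, b; for a, b >= 2 the subtractions are not truncated. *)
Definition g (a b : nat) : nat := a * b - a - b.

(* Main.v *)
(** Put [d = n - m], [K = s ^ d] and [l = m K + d].

    Upper bound. If a word of length [l] is not in [S^*], its factor of length [n]
    at position [j m] is in [T] for every [j < K]; consecutive such factors
    overlap in [d] letters, so the integers they encode increase by one at each
    step, which is impossible for [K] values at most [K - 2]. Hence [S^*] contains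
    every word of length [l] or [m], and thus every word whose length is a
    combination of [m] and [l].

    Lower bound. Consider the word of period [l] whose period lists the base-[s]
    representations of [0, ..., K - 1] separated by zeros. Its factors of length
    [n] at positions [j l + p m] with [p < K - 1] are in [T], so in any
    factorization over [S] every prefix has a length of the form [j l + c m]: a
    block of length [n] can only be used when [c >= K - 1], and it then replaces
    [j] by [j + 1]. The Frobenius number of [m] and [l] is not of that form. *)
Require Import Defs.
From mathcomp Require Import all_boot.
From mathcomp Require Import boolp classical_sets cardinality zify.

Local Open Scope classical_set_scope.

Lemma size_base_rep N k L : size (base_rep N k L) = L.
Proof. by elim: L N => //= L IH N; rewrite size_rcons IH. Qed.

Lemma base_rep_lt N k L d : 0 < k -> d \in base_rep N k L -> d < k.
Proof.
move=> k0; elim: L N => //= L IH N; rewrite mem_rcons inE => /orP[/eqP->|/IH//].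
by rewrite ltn_mod.
Qed.

Lemma base_rep_inj k L M N :
  M < k ^ L -> N < k ^ L -> base_rep M k L = base_rep N k L -> M = N.
Proof.
elim: L M N => [|L IH] M N; first by rewrite expn0; lia.
rewrite expnSr => hM hN /= /rcons_inj [e1 e2].
have k0 : 0 < k by case: (k) hM => //; rewrite muln0.
rewrite (divn_eq M k) (divn_eq N k) e2; congr (_ * _ + _).
by apply: IH => //; rewrite ltn_divLR.
Qed.

Section KleeneStar.
Context {A : eqType}.
Implicit Types (L : set (seq A)) (u v : seq A).

Lemma kleene_star_nil L : kleene_star L [::].
Proof. by exists [::]. Qed.

Lemma kleene_star_gen L u : L u -> kleene_star L u.
Proof.
move=> Lu; exists [:: u]; last by rewrite /= cats0.
by move=> v; rewrite inE => /eqP->.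
Qed.

Lemma kleene_star_cat L u v :
  kleene_star L u -> kleene_star L v -> kleene_star L (u ++ v).
Proof.
move=> [us hu ->] [vs hv ->]; exists (us ++ vs); last by rewrite flatten_cat.
by move=> x; rewrite mem_cat => /orP[/hu|/hv].
Qed.

Lemma kleene_star_uniform L a c u :
  (forall v, size v = a -> kleene_star L v) -> size u = c * a -> kleene_star L u.
Proof.
move=> hL; elim: c u => [|c IH] u su.
  by rewrite (size0nil su); exact: kleene_star_nil.
rewrite -(cat_take_drop a u); apply: kleene_star_cat.
  by apply: hL; rewrite size_takel // su mulSn leq_addr.
by apply: IH; rewrite size_drop su mulSn addKn.
Qed.

End KleeneStar.

Lemma finite_words_size_le (A : finType) N : finite_set [set w : seq A | size w <= N].
Proof.
apply: (@sub_finite_set _ _ (\bigcup_(i in `I_N.+1) range (@tval i A))).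
  by move=> w /= hw; exists (size w); [rewrite /= ltnS | exists (in_tuple w)].
apply: bigcup_finite => [|i _]; first exact: finite_II.
exact/finite_image/finite_finset.
Qed.

(** Let [u < a] solve [u * b = N] modulo [a]. If [u * b > N], then [u * b - N] is a positive
    multiple of [a], so [N <= (a - 1) * b - a = g a b]. *)
Lemma Frobenius_representable a b N :
  0 < a -> coprime a b -> g a b < N -> exists j c, N = j * b + c * a.
Proof.
move=> a0 cab hN; pose u := (chinese a b N 0 %/ b) %% a.
have ua : u < a by rewrite ltn_mod.
have hu : u * b = N %[mod a].
  rewrite /u modnMml divnK ?chinese_modl //.
  by rewrite /dvdn chinese_modr // mod0n.
have [uN|Nu] := leqP (u * b) N.
  exists u, ((N - u * b) %/ a); rewrite divnK ?subnKC //.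
  by rewrite -eqn_mod_dvd // hu.
have : a %| u * b - N by rewrite -eqn_mod_dvd ?hu // ltnW.
move/dvdn_leq; rewrite subn_gt0 => /(_ Nu).
by rewrite /g in hN; nia.
Qed.

(** Adding [a] to both sides gives [(a - 1) * b = j * b + c.+1 * a], so [a] divides [a - 1 - j],
    which lies strictly between [0] and [a]. *)
Lemma Frobenius_not_representable a b j c :
  1 < a -> 1 < b -> coprime a b -> g a b <> j * b + c * a.
Proof.
move=> a1 b1 cab e.
have e' : (a - 1) * b = j * b + c.+1 * a by rewrite /g in e; nia.
have hj : j < a by nia.
have : a %| (a - 1 - j) * b.
  by rewrite mulnBl e' addKn dvdn_mull.
rewrite Gauss_dvdl // => /dvdn_leq; nia.
Qed.

Section Words.
Variables (s m n : nat).
Hypotheses (hs : 2 <= s) (hmn : m < n) (hn2m : n < 2 * m).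
Local Notation d := (n - m).
Local Notation K := (s ^ d).
Local Notation l := (m * K + n - m).

Let K2 : 1 < K.
Proof. by rewrite -(expn0 s) ltn_exp2l // subn_gt0. Qed.

(** Words of [T m n] have length [2 * d + (2 * m - n) = n], which differs from [m]. *)
Lemma S_lang_size_m (u : seq 'I_s) : size u = m -> S_lang m n u.
Proof.
move=> su; split; first by left.
move=> [i _ /(congr1 size)].
by rewrite size_map !size_cat !size_base_rep size_nseq su; lia.
Qed.

Lemma kleene_star_size_l (w : seq 'I_s) :
  size w = l -> kleene_star (S_lang m n) w.
Proof.
move=> sw; apply: contrapT => nw.
have sM c (u : seq 'I_s) : size u = c * m -> kleene_star (S_lang m n) u.
  by apply: kleene_star_uniform => v /S_lang_size_m /kleene_star_gen.
have hT j : j < K -> T m n (take n (drop (j * m) w)).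
  move=> jK; apply: contrapT => nT; apply: nw.
  have [x [ex jm]] : exists x, x = (K - 1 - j) * m /\ j * m + n + x = l.
    by exists ((K - 1 - j) * m); split => //; nia.
  rewrite -(cat_take_drop (j * m) w) -[drop _ w](cat_take_drop n).
  apply: kleene_star_cat.
    by apply: (sM j); rewrite size_takel // sw; lia.
  apply: kleene_star_cat.
    apply: kleene_star_gen; split => //; right.
    by rewrite /words_of_length /= size_takel // size_drop sw; lia.
  by apply: (sM (K - 1 - j)); rewrite !size_drop sw -ex; lia.
(* Only [j <= i] is kept of the growth of the encoded integers; at [j = K - 1] it contradicts
   [i <= K - 2]. *)
have hi j : j < K -> exists i, [/\ j <= i, i <= K - 2 &
    map val (take n (drop (j * m) w)) =
    base_rep i s d ++ nseq (2 * m - n) 0 ++ base_rep i.+1 s d].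
  elim: j => [|j IH] jK; first by have [i] := hT 0 jK; exists i.
  have [i [ji iK ei]] := IH (ltnW jK).
  have [i' i'K ei'] := hT _ jK.
  exists i'; split => //; suff -> : i' = i.+1 by [].
  apply: (@base_rep_inj s d); [lia | lia |].
  (* The first [d] letters of the factor at [j.+1 * m] are the last [d] letters of the one at
     [j * m]. *)
  move/(congr1 (take d)): ei'; rewrite take_size_cat ?size_base_rep // => <-.
  move/(congr1 (drop m)): ei; rewrite catA drop_size_cat; last first.
    by rewrite size_cat size_base_rep size_nseq; lia.
  move=> <-; rewrite -map_take -map_drop take_takel; last lia.
  by rewrite -{2}(subnK (ltnW hmn)) -take_drop drop_drop mulSn.
by have [|i [? ?]] := hi (K - 1); lia.
Qed.

Lemma kleene_star_combination j c (w : seq 'I_s) :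
  size w = j * l + c * m -> kleene_star (S_lang m n) w.
Proof.
move=> sw; rewrite -(cat_take_drop (j * l) w); apply: kleene_star_cat.
  apply: (@kleene_star_uniform _ _ l j) kleene_star_size_l _.
  by rewrite size_takel // sw leq_addr.
apply: (@kleene_star_uniform _ _ m c); last by rewrite size_drop sw addKn.
by move=> v /S_lang_size_m /kleene_star_gen.
Qed.

(** The arbitrary remainder [v] lets the induction peel off the last block while [w] stays fixed. *)
Lemma size_flatten_S_lang (w v : seq 'I_s) us :
  (forall j p, p < K - 1 -> j * l + p * m + n <= size w ->
     T m n (take n (drop (j * l + p * m) w))) ->
  (forall u, u \in us -> S_lang m n u) -> w = flatten us ++ v ->
  exists j c, size (flatten us) = j * l + c * m.
Proof.
move=> hw; elim/last_ind: us v => [|us u IH] v hus; first by exists 0, 0.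
rewrite flatten_rcons -catA => ew.
have [u' hu'|j [c e]] := IH _ _ ew.
  by apply: hus; rewrite mem_rcons inE hu' orbT.
have [su nTu] : S_lang m n u by apply: hus; rewrite mem_rcons mem_head.
case: su => su; rewrite size_cat e su; first by exists j, c.+1; lia.
have [cK|Kc] := ltnP c (K - 1).
  case: nTu; suff -> : u = take n (drop (j * l + c * m) w).
    by apply: hw => //; rewrite ew !size_cat e su addnA leq_addr.
  by rewrite ew drop_size_cat // take_size_cat.
(* Here [l = (K - 1) * m + n], so a block of length [n] trades [K - 1] copies of [m] for one [l]. *)
by exists j.+1, (c - (K - 1)); nia.
Qed.

(* [base_rep K s d] is [0^d], and [nth] is [0] past the end of a
   representation, so this letter is right for the padding as well. *)
Definition periodic_letter q := nth 0 (base_rep (q %% l %/ m) s d) (q %% l %% m).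

Lemma periodic_letter_lt q : periodic_letter q < s.
Proof.
have s0 : 0 < s by exact: ltnW.
rewrite /periodic_letter; case: (ltnP (q %% l %% m) d) => h; last first.
  by rewrite nth_default // size_base_rep.
by apply: base_rep_lt s0 (mem_nth _ _); rewrite size_base_rep.
Qed.

Definition periodic_word L : seq 'I_s :=
  mkseq (fun q => Ordinal (periodic_letter_lt q)) L.

Lemma T_periodic_word L j p : p < K - 1 -> j * l + p * m + n <= L ->
  T m n (take n (drop (j * l + p * m) (periodic_word L))).
Proof.
move=> pK hL; exists p; first lia.
rewrite map_take map_drop /periodic_word /mkseq -map_comp.
have sz : size (take n (drop (j * l + p * m)
    [seq (val \o (fun q => Ordinal (periodic_letter_lt q))) i | i <- iota 0 L])) = n.
  by rewrite size_takel // size_drop size_map size_iota; lia.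
apply: (@eq_from_nth _ 0).
  by rewrite sz !size_cat !size_base_rep size_nseq; lia.
move=> q; rewrite sz => qn.
rewrite nth_take // nth_drop (nth_map 0) ?size_iota; last lia.
rewrite nth_iota /=; last lia.
rewrite add0n /periodic_letter -addnA modnMDl modn_small; last nia.
have m0 : 0 < m by lia.
rewrite divnMDl // modnMDl !nth_cat size_base_rep size_nseq nth_nseq.
(* The first [m] letters are the digits of [p] and the padding; the other [d] open the next block,
   with the digits of [p.+1]. *)
have [qm|mq] := ltnP q m.
  rewrite divn_small // addn0 modn_small //.
  case: ltnP => // dq; rewrite nth_default ?size_base_rep //.
  by case: ltnP => //; lia.
have -> : q = 1 * m + (q - m) by lia.
rewrite divnMDl // modnMDl divn_small ?modn_small; [|lia..].
do 2 (case: ltnP => [|_]; first lia).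
by rewrite addn0 addn1; congr nth; lia.
Qed.

End Words.

Theorem theorem23 (s m n : nat) (hs : 2 <= s) (hm : 0 < m) (hmn : m < n)
    (hn2m : n < 2 * m) (hgcd : gcdn m n = 1) :
  let S : set (seq 'I_s) := S_lang m n in
  let l := m * s ^ (n - m) + n - m in
  cofinite_language (kleene_star S) /\
  (exists2 w : seq 'I_s, (~` kleene_star S) w & size w = g m l) /\
  (forall w : seq 'I_s, (~` kleene_star S) w -> size w <= g m l).
Proof.
move=> S l.
have cml : coprime m l.
  rewrite /l -addnBA ?(ltnW hmn) // /coprime mulnC gcdnMDl.
  by rewrite -(gcdnDr m) subnK ?(ltnW hmn) // hgcd.
have bound w : (~` kleene_star S) w -> size w <= g m l.
  move=> nw; rewrite leqNgt; apply/negP => /(Frobenius_representable _ _ _ hm cml).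
  by move=> [j [c e]]; apply: nw; exact: (kleene_star_combination s m n hs hmn hn2m j c).
split; [|split => //].
  exact: sub_finite_set bound (finite_words_size_le _ _).
exists (periodic_word s m n hs (g m l)); last by rewrite size_mkseq.
move=> [us hus ew].
have [| |j [c]] := size_flatten_S_lang s m n hs hmn hn2m
  (periodic_word s m n hs (g m l)) [::] us _ hus.
- by move=> j p pK; rewrite size_mkseq; exact: T_periodic_word.
- by rewrite cats0.
rewrite -ew size_mkseq; apply: Frobenius_not_representable => //; first lia.
have : 0 < s ^ (n - m) by rewrite expn_gt0; lia.
by rewrite /l; nia.
Qed.
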